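(* Let $k\ge 2$ be an integer and let $\mathcal{A}$ be a dual Banach algebra with a predual $F$ such that $aF^{\perp}=F^{\perp}a=0$ for each $a\in\mathcal{A}$ and $m\Box m=0$ for each $m\in F^{\perp}$. If $\mathcal{A}$ has the $k$-OA property, then $(\mathcal{A}^{**},\Box)$ has the $k$-OA property.
   Context: All Banach algebras are over $\mathbb{C}$. For a Banach algebra $\mathcal{B}$, a $k$-homogeneous polynomial on $\mathcal{B}$ is a map $P:\mathcal{B}\to\mathbb{C}$ for which there is a bounded symmetric $k$-linear form $\Phi:\mathcal{B}^k\to\mathbb{C}$ with $P(x)=\Phi(x,\ldots,x)$ for all $x\in\mathcal{B}$. $P$ is orthogonally additive if $P(x+y)=P(x)+P(y)$ whenever $x,y\in\mathcal{B}$ satisfy $xy=0=yx$. $P$ is standard if there is $\gamma\in\mathcal{B}^*$ with $P(x)=\langle\gamma,x^k\rangle$ for all $x\in\mathcal{B}$. $\mathcal{B}$ has the $k$-OA property ($k$-orthogonally additive property) if every orthogonally additive $k$-homogeneous polynomial on $\mathcal{B}$ is standard. The bidual $\mathcal{A}^{**}$ is a Banach algebra with the first Arens product $\Box$, given by $m\Box n=\mathrm{w}^*\text{-}\lim_\alpha \mathrm{w}^*\text{-}\lim_\beta a_\alpha b_\beta$ for nets $(a_\alpha),(b_\beta)$ in $\mathcal{A}$ weak$^*$-converging to $m,n\in\mathcal{A}^{**}$ respectively (with $\mathcal{A}$ canonically embedded in $\mathcal{A}^{**}$). A Banach algebra $\mathcal{A}$ is a dual Banach algebra with predual $F$ if $\mathcal{A}=F^*$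 for the Banach space $F$ and $F$, canonically embedded in $F^{**}=\mathcal{A}^*$, is an $\mathcal{A}$-submodule of $\mathcal{A}^*$. Write $F^{\perp}=\{m\in\mathcal{A}^{**}: m \text{ vanishes on } F\}$; it is a closed ideal of $(\mathcal{A}^{**},\Box)$ and $\mathcal{A}^{**}=\mathcal{A}\oplus F^{\perp}$. The products $aF^\perp$ and $F^\perp a$ are taken in $(\mathcal{A}^{**},\Box)$. *)

(* Defs.v *)
From HB Require Import structures.
From mathcomp Require Import all_boot all_order all_algebra fingroup perm.
From mathcomp Require Import complex ring.
From mathcomp Require Import boolp classical_sets functions filter reals.
From mathcomp Require Import topology normedtype.

Set Implicit Arguments.
Unset Strict Implicit.
Unset Printing Implicit Defensive.

Import Order.TTheory GRing.Theory Num.Theory.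
Import numFieldNormedType.Exports.

Local Open Scope classical_set_scope.
Local Open Scope ring_scope.
Local Open Scope complex_scope.

HB.instance Definition _ (R : rcfType) := NormedModule.copy R[i] R[i]^o.

Section complex_complete.
Variable R : realType.
Implicit Types z w : R[i].

Lemma complex_abs_Re z : `|complex.Re z|%:C <= `|z|.
Proof.
case: z => a b; rewrite normc_def /= lecR -sqrtr_sqr ler_wsqrtr//.
by rewrite lerDl sqr_ge0.
Qed.

Lemma complex_abs_Im z : `|complex.Im z|%:C <= `|z|.
Proof.
case: z => a b; rewrite normc_def /= lecR -sqrtr_sqr ler_wsqrtr//.
by rewrite lerDr sqr_ge0.
Qed.

Lemma ge0_ReK z : 0 <= z -> (complex.Re z)%:C = z.
Proof. by case: z => a b; rewrite lecE/= => /andP[/eqP->]. Qed.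

Lemma complex_le_ReIm z : `|z| <= (`|complex.Re z| + `|complex.Im z|)%:C.
Proof.
rewrite [z in leLHS]complexE (le_trans (ler_normD _ _))//.
rewrite normrM !normc_def/= !expr0n/= !addr0 !add0r expr1n.
by rewrite !sqrtr_sqr sqrtr1 mul1r rmorphD.
Qed.

Lemma complex_cauchy_cvg (F : set_system R[i]) :
  ProperFilter F -> cauchy F -> cvg F.
Proof.
move=> FF /cauchy_ballP cF.
have cauchy_part (f : R[i] -> R) : (forall z w, f (z - w) = f z - f w) ->
    (forall z, `|f z|%:C <= `|z|) -> cvg (f @ F).
  move=> fB fle; apply/cauchy_cvgP/cauchy_ballP => e e0.
  have e0' : 0 < e%:C :> R[i] by rewrite ltcR.
  have := cF _ e0'; rewrite !near_simpl/= near_map2.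
  apply: filterS => -[z w] /=; rewrite -!ball_normE/= => zw.
  by rewrite -ltcR -fB (le_lt_trans (fle _)).
have cRe : cvg (@complex.Re R @ F).
  by apply: cauchy_part; [case=> [? ?] [? ?]|exact: complex_abs_Re].
have cIm : cvg (@complex.Im R @ F).
  by apply: cauchy_part; [case=> [? ?] [? ?]|exact: complex_abs_Im].
apply/cvg_ex; exists (lim (@complex.Re R @ F) +i* lim (@complex.Im R @ F)).
apply/cvgrPdist_lt => e e0.
have eE : (complex.Re e)%:C = e by apply: ge0_ReK; exact: ltW.
have e2 : 0 < complex.Re e / 2 by rewrite divr_gt0// -ltcR eE.
move/cvgrPdist_lt : cRe => /(_ _ e2) cRe; move/cvgrPdist_lt : cIm => /(_ _ e2) cIm.
near=> z; rewrite (le_lt_trans (complex_le_ReIm _))// -eE ltcR.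
rewrite (splitr (complex.Re e)) ltrD//.
  by near: z; apply: filterS cRe; case=> /=.
by near: z; apply: filterS cIm; case=> /=.
Unshelve. all: by end_near. Qed.

End complex_complete.

HB.instance Definition _ (R : realType) :=
  Uniform_isComplete.Build R[i] (@complex_cauchy_cvg R).

Section dual_lmodule.
Variables (R : realType) (V : normedModType R[i]).

Definition bounded_functional : {pred V -> R[i]} :=
  fun f => `[< scalar f /\ exists M : R[i], forall x, `|f x| <= M * `|x| >].

Record dual := Dual {
  dual_fun :> V -> R[i];
  dual_funP : dual_fun \in bounded_functional }.

HB.instance Definition _ := [isSub of dual for dual_fun].
HB.instance Definition _ := [Choice of dual by <:].

Lemma bounded_functional_submod_closed : submod_closed bounded_functional.
Proof.
split.
  apply/asboolP; split; first by move=> a x y /=; rewrite mulr0 addr0.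
  by exists 0 => x /=; rewrite mul0r normr0.
move=> a f g /asboolP[lf [M fM]] /asboolP[lg [N gN]]; apply/asboolP; split.
  have E z : (a *: f + g) z = a * f z + g z by [].
  by move=> b x y; rewrite !E lf lg; ring.
exists (`|a| * M + N) => x; rewrite (le_trans (ler_normD _ _))//.
by rewrite mulrDl -mulrA lerD// normrM ler_wpM2l.
Qed.

HB.instance Definition _ := GRing.isSubmodClosed.Build _ _ bounded_functional
  bounded_functional_submod_closed.
HB.instance Definition _ := [SubChoice_isSubLmodule of dual by <:].

Lemma dual_scalar (f : dual) : scalar f.
Proof. by have /asboolP[] := dual_funP f. Qed.

HB.instance Definition _ (f : dual) :=
  GRing.isLinear.Build R[i] V R[i] _ f (dual_scalar f).

Definition mk_dual (f : V -> R[i]) (fl : scalar f) (M : R[i])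
  (fM : forall x, `|f x| <= M * `|x|) : dual :=
  Dual (asboolT (conj fl (ex_intro _ M fM))).

Lemma dualP (f g : dual) : (forall x, f x = g x) -> f = g.
Proof. by move=> fg; apply/val_inj/funext. Qed.

Lemma dualDE (f g : dual) x : (f + g) x = f x + g x. Proof. by []. Qed.
Lemma dualZE a (f : dual) x : (a *: f) x = a * f x. Proof. by []. Qed.
Lemma dualNE (f : dual) x : (- f) x = - f x. Proof. by []. Qed.
Lemma dualBE (f g : dual) x : (f - g) x = f x - g x. Proof. by []. Qed.
Lemma dual0E x : (0 : dual) x = 0. Proof. by []. Qed.

End dual_lmodule.

Section dual_norm.
Variables (R : realType) (V : normedModType R[i]).
Implicit Types (f g : dual V).

(* As for every normed module over [R[i]], the norm takes its values in the
   nonnegative reals of [R[i]]. *)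
Definition dual_norm f : R[i] :=
  (sup [set complex.Re `|f x| | x in [set x : V | `|x| <= 1]])%:C.

Lemma dual_norm_has_sup f :
  has_sup [set complex.Re `|f x| | x in [set x : V | `|x| <= 1]].
Proof.
split; first by exists (complex.Re `|f 0|); exists 0 => //=; rewrite normr0.
have /asboolP[_ [M fM]] := dual_funP f.
exists (complex.Re `|M|) => _ [x x1 <-].
rewrite -lecR !ge0_ReK// (le_trans (fM x))//.
rewrite (le_trans (real_ler_norm _))//.
  by rewrite ger0_real// (le_trans _ (fM x)).
by rewrite normrM normr_id ler_piMr.
Qed.

Lemma dual_norm_ge0 f : 0 <= dual_norm f.
Proof.
rewrite /dual_norm ler0c; apply: ub_le_sup.
  by have [] := dual_norm_has_sup f.
exists 0; first by rewrite /= normr0.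
by rewrite linear0 normr0.
Qed.

Lemma le_dual_norm f x : `|f x| <= dual_norm f * `|x|.
Proof.
have [->|x0] := eqVneq x 0; first by rewrite linear0 !normr0 mulr0.
have nx0 : 0 < `|x| by rewrite normr_gt0.
rewrite -ler_pdivrMr// mulrC.
have -> : `|x|^-1 * `|f x| = `|f (`|x|^-1 *: x)|.
  by rewrite linearZ normrM gtr0_norm// invr_gt0.
rewrite -(ge0_ReK (normr_ge0 _)) lecR; apply: ub_le_sup.
  by have [] := dual_norm_has_sup f.
exists (`|x|^-1 *: x) => //=.
by rewrite normrZ gtr0_norm ?invr_gt0// mulVf// gt_eqF.
Qed.

Lemma dual_norm_le f M : 0 <= M -> (forall x, `|f x| <= M * `|x|) ->
  dual_norm f <= M.
Proof.
move=> M0 fM; rewrite -(ge0_ReK M0) lecR; apply: ge_sup.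
  by have [] := dual_norm_has_sup f.
move=> _ [x x1 <-]; rewrite -lecR !ge0_ReK//.
by rewrite (le_trans (fM x))// ler_piMr.
Qed.

Lemma dual_normD f g : dual_norm (f + g) <= dual_norm f + dual_norm g.
Proof.
apply: dual_norm_le => [|x]; first by rewrite addr_ge0// dual_norm_ge0.
by rewrite dualDE (le_trans (ler_normD _ _))// mulrDl lerD// le_dual_norm.
Qed.

Lemma dual_normZ_le a f : dual_norm (a *: f) <= `|a| * dual_norm f.
Proof.
apply: dual_norm_le => [|x]; first by rewrite mulr_ge0// dual_norm_ge0.
by rewrite dualZE normrM -mulrA ler_wpM2l// le_dual_norm.
Qed.

Lemma dual_normZ a f : dual_norm (a *: f) = `|a| * dual_norm f.
Proof.
apply/eqP; rewrite eq_le dual_normZ_le /=.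
have [->|a0] := eqVneq a 0; first by rewrite normr0 mul0r dual_norm_ge0.
rewrite -ler_pdivlMl ?normr_gt0// -normfV (le_trans _ (dual_normZ_le _ _))//.
by rewrite scalerA mulVf// scale1r.
Qed.

Lemma dual_norm0_eq0 f : dual_norm f = 0 -> f = 0.
Proof.
move=> f0; apply/dualP => x; apply/eqP.
by rewrite -normr_le0 (le_trans (le_dual_norm f x))// f0 mul0r.
Qed.

HB.instance Definition _ := Lmodule_isNormed.Build R[i] (dual V)
  dual_normD dual_normZ dual_norm0_eq0.

Lemma dual_normE f : `|f| = dual_norm f. Proof. by []. Qed.

Lemma ler_dual f x : `|f x| <= `|f| * `|x|.
Proof. exact: le_dual_norm. Qed.

Lemma dual_ler f M : 0 <= M -> (forall x, `|f x| <= M * `|x|) -> `|f| <= M.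
Proof. exact: dual_norm_le. Qed.

Lemma mk_dual_ler h (hl : scalar h) M (hM : forall x, `|h x| <= M * `|x|) :
  0 <= M -> `|mk_dual hl hM : dual V| <= M.
Proof. by move=> M0; exact: dual_ler. Qed.

Lemma dual_cauchy_cvg (F : set_system (dual V)) :
  ProperFilter F -> cauchy F -> cvg F.
Proof.
move=> FF /cauchy_ballP cF.
have cx x : cvg ((fun f : dual V => f x) @ F).
  apply/cauchy_cvgP/cauchy_ballP => e e0.
  have k0 : 0 < `|x| + 1 by rewrite ltr_wpDl.
  have e0' : 0 < e / (`|x| + 1) by rewrite divr_gt0.
  have := cF _ e0'; rewrite !near_simpl/= near_map2.
  apply: filterS => -[f g] /=; rewrite -!ball_normE/= => fg.
  rewrite -dualBE (le_lt_trans (ler_dual _ _))//.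
  rewrite (@le_lt_trans _ _ (`|f - g| * (`|x| + 1)))//.
    by rewrite ler_wpM2l// lerDl.
  by rewrite -ltr_pdivlMr.
pose l x := lim ((fun f : dual V => f x) @ F).
have ll : scalar l.
  move=> a x y; rewrite /l.
  apply: (cvg_lim (@norm_hausdorff _ R[i])).
  have -> : (fun f : dual V => f (a *: x + y)) =
      (fun f : dual V => a * f x + f y).
    by apply/funext => f; rewrite linearP.
  by apply: (@cvgD _ R[i]^o); [apply: cvgMr => //; exact: cx|exact: cx].
have near_l (e : R[i]) : 0 < e -> \forall f \near F, forall x,
    `|l x - (f : dual V) x| <= e * `|x|.
  move=> e0; have := cF _ e0; rewrite near_simpl => /nearP_dep.
  apply: filterS => f fg x.
  apply/ler_addgt0Pr => d d0.
  have /cvgrPdist_lt/(_ _ d0) xl := cx x.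
  near F => g.
  rewrite -[l x](subrK (g x)) -addrA addrC (le_trans (ler_normD _ _))//.
  rewrite lerD//; last by rewrite ltW//; near: g.
  rewrite -dualBE (le_trans (ler_dual _ _))// ler_wpM2r// distrC ltW//.
  by near: g; apply: filterS fg => h; rewrite -ball_normE.
have [M lM] : exists M : R[i], forall x, `|l x| <= M * `|x|.
  have [f fP] := filter_ex (near_l _ ltr01).
  exists (1 + `|f|) => x; rewrite mulrDl.
  by rewrite -[l x](subrK (f x)) (le_trans (ler_normD _ _))// lerD// ler_dual.
apply/cvg_ex; exists (mk_dual ll lM); apply/cvgrPdist_le => e e0.
apply: filterS (near_l _ e0) => f fP; apply: dual_ler => //; exact: ltW.
Unshelve. all: by end_near. Qed.

HB.instance Definition _ := Uniform_isComplete.Build (dual V) dual_cauchy_cvg.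

End dual_norm.

HB.mixin Record isBanachAlgebra (K : numFieldType) A
    & CompleteNormedModule K A := {
  bmul : A -> A -> A;
  bmulA : associative bmul;
  bmulDl : left_distributive bmul +%R;
  bmulDr : right_distributive bmul +%R;
  bmulZl : forall (c : K) (x y : A), bmul (c *: x) y = c *: bmul x y;
  bmulZr : forall (c : K) (x y : A), bmul x (c *: y) = c *: bmul x y;
  ler_norm_bmul : forall x y : A, `|bmul x y| <= `|x| * `|y|
}.

#[short(type="banachAlgType")]
HB.structure Definition BanachAlgebra (K : numFieldType) :=
  {A of CompleteNormedModule K A & isBanachAlgebra K A}.

Notation "x ** y" := (bmul x y) (at level 40, left associativity) : ring_scope.

(* Banach algebras need not be unital, so powers start at k = 1; [bexp x 0] is
   the junk value 0. *)
Definition bexp (K : numFieldType) (A : banachAlgType K) (x : A) (k : nat) : A :=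
  iterop k bmul x 0.

Section wstar.
Variable R : realType.

Definition wstar_cvg (E : normedModType R[i]) (T : Type) (u : T -> dual E)
    (F : set_system T) (p : dual E) : Prop :=
  forall x : E, (fun t => u t x) @ F --> p x.

Definition bidual (V : normedModType R[i]) : Type := dual (dual V).

HB.instance Definition _ (V : normedModType R[i]) :=
  CompleteNormedModule.copy (bidual V) (dual (dual V)).

Section embed.
Variable V : normedModType R[i].

Fact embed_scalar (x : V) : scalar (fun f : dual V => f x).
Proof. by []. Qed.

Fact embed_bound (x : V) (f : dual V) : `|f x| <= `|x| * `|f|.
Proof. by rewrite mulrC ler_dual. Qed.

Definition embed (x : V) : bidual V := mk_dual (embed_scalar x) (embed_bound x).

Lemma embedE x f : embed x f = f x. Proof. by []. Qed.

Lemma bidual_vanish (s : seq (dual V)) (f : dual V) :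
    (forall x, (forall g, g \in s -> g x = 0) -> f x = 0) ->
  forall m : bidual V, (forall g, g \in s -> m g = 0) -> m f = 0.
Proof.
elim: s f => [|g s IH] f sf m ms.
  suff -> : f = 0 by rewrite linear0.
  by apply/dualP => x; apply: sf.
have ms' h : h \in s -> m h = 0 by move=> hs; rewrite ms// in_cons hs orbT.
have [gs|] := pselect (forall x, (forall h, h \in s -> h x = 0) -> g x = 0).
  apply: (IH) ms' => x xs; apply: sf => h; rewrite in_cons => /orP[/eqP->|].
    exact: gs.
  exact: xs.
move=> /existsNP[b /not_implyP[bs /eqP gb0]].
have : m (f - (f b / g b) *: g) = 0.
  apply: (IH) ms' => x xs.
  have fE : f (x - (g x / g b) *: b) = 0.
    apply: sf => h; rewrite in_cons => /orP[/eqP->|hs].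
      by rewrite linearB linearZ/= mulrVK ?unitfE// subrr.
    by rewrite linearB linearZ/= (xs h)// (bs h)// mulr0 subrr.
  rewrite linearB linearZ/= in fE.
  by rewrite dualBE dualZE -[RHS]fE; congr (_ - _); ring.
by rewrite linearB linearZ/= (ms g) ?mem_head// mulr0 subr0.
Qed.

Lemma bidual_interpolation (m : bidual V) (s : seq (dual V)) :
  exists x : V, forall g, g \in s -> g x = m g.
Proof.
elim: s => [|f s [x xs]]; first by exists 0.
have [fs|] := pselect (forall y, (forall h, h \in s -> h y = 0) -> f y = 0).
  exists x => g; rewrite in_cons => /orP[/eqP->|/xs//].
  apply/eqP; rewrite eq_sym -subr_eq0; apply/eqP.
  apply: (bidual_vanish fs (m := m - embed x)) => h hs.
  by rewrite dualBE embedE xs// subrr.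
move=> /existsNP[b /not_implyP[bs /eqP fb0]].
exists (x + ((m f - f x) / f b) *: b) => g; rewrite in_cons => /orP[/eqP->|gs].
  by rewrite linearD linearZ/= mulrVK ?unitfE// addrC subrK.
by rewrite linearD linearZ/= (bs g)// mulr0 addr0 xs.
Qed.

Lemma bidual_wstar_dense (m : bidual V) : exists2 F : set_system V,
  ProperFilter F & wstar_cvg embed F m.
Proof.
pose B (s : seq (dual V)) := [set x : V | forall g, g \in s -> g x = m g].
pose F : set_system V := [set U | exists s, B s `<=` U].
have FF : ProperFilter F.
  split.
    by move=> [s]; have [x xs] := bidual_interpolation m s => /(_ x); exact.
  split.
  - by exists [::].
  - move=> P Q [s sP] [t tQ]; exists (s ++ t) => x xst; split.
      by apply: sP => g gs; rewrite xst// mem_cat gs.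
    by apply: tQ => g gs; rewrite xst// mem_cat gs orbT.
  - by move=> P Q PQ [s sP]; exists s; exact: subset_trans PQ.
exists F => // f; apply: cvg_near_cst; exists [:: f] => x /(_ f).
by rewrite mem_head; exact.
Qed.

End embed.

End wstar.

Section arens_def.
Variables (R : realType) (A : banachAlgType R[i]).
Implicit Types (a b : A) (f : dual A) (m n p : bidual A).

Fact dual_ract_scalar f a : scalar (fun b => f (a ** b)).
Proof. by move=> c x y; rewrite bmulDr bmulZr linearP. Qed.

Fact dual_ract_bound f a b : `|f (a ** b)| <= `|f| * `|a| * `|b|.
Proof.
by rewrite (le_trans (ler_dual _ _))// -mulrA ler_wpM2l// ler_norm_bmul.
Qed.

(* The dual module actions: [(f . a)(b) = f(ab)] and [(a . f)(b) = f(ba)]. *)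
Definition dual_ract f a : dual A :=
  mk_dual (dual_ract_scalar f a) (dual_ract_bound f a).

Fact dual_lact_scalar a f : scalar (fun b => f (b ** a)).
Proof. by move=> c x y; rewrite bmulDl bmulZl linearP. Qed.

Fact dual_lact_bound a f b : `|f (b ** a)| <= `|f| * `|a| * `|b|.
Proof.
rewrite (le_trans (ler_dual _ _))// -mulrA ler_wpM2l//.
by rewrite mulrC ler_norm_bmul.
Qed.

Definition dual_lact a f : dual A :=
  mk_dual (dual_lact_scalar a f) (dual_lact_bound a f).

(* Nets are replaced by filters: [G] and [H] stand for the nets [(a_alpha)] and
   [(b_beta)], and [q a] is the weak-star limit of [a ** b] along [H]. *)
Definition is_arens_product m n p : Prop :=
  forall G H : set_system A, ProperFilter G -> ProperFilter H ->
    wstar_cvg (@embed R A) G m -> wstar_cvg (@embed R A) H n ->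
  exists q : A -> bidual A,
    (forall a, wstar_cvg (fun b => embed (a ** b)) H (q a)) /\
    wstar_cvg q G p.

End arens_def.

(* [arensP] and [arens_unique] show that this choice is well defined. *)
HB.lock Definition arens (R : realType) (A : banachAlgType R[i])
    (m n : bidual A) : bidual A :=
  xget 0 [set p | is_arens_product m n p].
Canonical arens_unlockable := Unlockable arens.unlock.
Arguments arens {R A} m n.

Section arens.
Variables (R : realType) (A : banachAlgType R[i]).
Implicit Types (a b : A) (f : dual A) (m n p : bidual A).

(* The adjoint form of the product: [(n . f)(a) = n(f . a)] and
   [(m [] n)(f) = m(n . f)]. *)
Fact bidual_act_scalar n f : scalar (fun a => n (dual_ract f a)).
Proof.
move=> c x y; rewrite -linearP; congr (n _); apply/dualP => b.
by rewrite dualDE dualZE/= bmulDl bmulZl linearP.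
Qed.

Fact bidual_act_bound n f a : `|n (dual_ract f a)| <= `|n| * `|f| * `|a|.
Proof.
rewrite (le_trans (ler_dual _ _))// -mulrA ler_wpM2l//.
by apply: mk_dual_ler; rewrite mulr_ge0.
Qed.

Definition bidual_act n f : dual A :=
  mk_dual (bidual_act_scalar n f) (bidual_act_bound n f).

Fact arens_adj_scalar m n : scalar (fun f => m (bidual_act n f)).
Proof.
move=> c f g; rewrite -linearP; congr (m _); apply/dualP => a.
rewrite dualDE dualZE/= -linearP; congr (n _); exact/dualP.
Qed.

Fact arens_adj_bound m n f : `|m (bidual_act n f)| <= `|m| * `|n| * `|f|.
Proof.
rewrite (le_trans (ler_dual _ _))// -mulrA ler_wpM2l//.
by apply: mk_dual_ler; rewrite mulr_ge0.
Qed.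

Definition arens_adj m n : bidual A :=
  mk_dual (arens_adj_scalar m n) (arens_adj_bound m n).

Lemma arens_adjP m n : is_arens_product m n (arens_adj m n).
Proof.
move=> G H GF HF Gm Hn; exists (fun a => arens_adj (embed a) n); split.
  by move=> a f; exact: (Hn (dual_ract f a)).
by move=> f; exact: (Gm (bidual_act n f)).
Qed.

Lemma arens_unique m n p p' :
  is_arens_product m n p -> is_arens_product m n p' -> p = p'.
Proof.
have [G GF Gm] := bidual_wstar_dense m; have [H HF Hn] := bidual_wstar_dense n.
move=> /(_ G H GF HF Gm Hn)[q [Hq Gp]] /(_ G H GF HF Gm Hn)[q' [Hq' Gp']].
have qq' : q = q'.
  apply/funext => a; apply/dualP => f.
  exact: (cvg_unique (@norm_hausdorff _ R[i]) (Hq a f) (Hq' a f)).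
rewrite -qq' in Gp'; apply/dualP => f.
exact: (cvg_unique (@norm_hausdorff _ R[i]) (Gp f) (Gp' f)).
Qed.

Lemma arensP m n : is_arens_product m n (arens m n).
Proof. by rewrite unlock; exact: (xgetI 0 (@arens_adjP m n)). Qed.

Lemma arensE m n f : arens m n f = m (bidual_act n f).
Proof. by rewrite (arens_unique (@arensP m n) (@arens_adjP m n)). Qed.

Lemma arensA : associative (@arens R A).
Proof.
move=> m n p; apply/dualP => f; rewrite !arensE; congr (m _).
apply/dualP => a; rewrite /= arensE; congr (n _); apply/dualP => b /=.
by congr (p _); apply/dualP => c; rewrite /= bmulA.
Qed.

Lemma arensDl : left_distributive (@arens R A) +%R.
Proof. by move=> m n p; apply/dualP => f; rewrite dualDE !arensE. Qed.

Lemma arensDr : right_distributive (@arens R A) +%R.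
Proof.
move=> m n p; apply/dualP => f; rewrite dualDE !arensE -linearD.
by congr (m _); apply/dualP.
Qed.

Lemma arensZl (c : R[i]) m n : arens (c *: m) n = c *: arens m n.
Proof. by apply/dualP => f; rewrite dualZE !arensE. Qed.

Lemma arensZr (c : R[i]) m n : arens m (c *: n) = c *: arens m n.
Proof.
apply/dualP => f; rewrite dualZE !arensE -linearZ.
by congr (m _); apply/dualP.
Qed.

Lemma ler_norm_arens m n : `|arens m n| <= `|m| * `|n|.
Proof.
apply: dual_ler => [|f]; first by rewrite mulr_ge0.
by rewrite arensE arens_adj_bound.
Qed.

HB.instance Definition _ := isBanachAlgebra.Build R[i] (bidual A)
  arensA arensDl arensDr arensZl arensZr ler_norm_arens.

End arens.

Section orthogonally_additive.
Variables (R : realType) (B : banachAlgType R[i]).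
Implicit Types P : B -> R[i].

Definition multilinear_form k (Phi : ('I_k -> B) -> R[i]) : Prop :=
  forall (x : 'I_k -> B) (i : 'I_k),
    scalar (fun t : B => Phi (dfwith x (i := i) t)).

Definition symmetric_form k (Phi : ('I_k -> B) -> R[i]) : Prop :=
  forall (s : 'S_k) (x : 'I_k -> B), Phi (x \o s) = Phi x.

Definition bounded_form k (Phi : ('I_k -> B) -> R[i]) : Prop :=
  exists M : R[i], forall x : 'I_k -> B, `|Phi x| <= M * \prod_(i < k) `|x i|.

Definition homogeneous_polynomial k P : Prop :=
  exists Phi : ('I_k -> B) -> R[i],
    [/\ multilinear_form Phi, symmetric_form Phi, bounded_form Phi
      & forall x, P x = Phi (fun=> x)].

Definition orthogonally_additive P : Prop :=
  forall x y, x ** y = 0 -> y ** x = 0 -> P (x + y) = P x + P y.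

Definition standard_polynomial k P : Prop :=
  exists g : dual B, forall x, P x = g (bexp x k).

Definition OA_property k : Prop :=
  forall P, homogeneous_polynomial k P -> orthogonally_additive P ->
    standard_polynomial k P.

End orthogonally_additive.
Arguments OA_property {R} B k.

Section dual_banach_algebra.
Variables (R : realType) (A : banachAlgType R[i]).
Variable F : completeNormedModType R[i].

Record isometric_iso (U V : normedModType R[i]) := IsometricIso {
  isometric_fun :> {linear U -> V};
  isometric_norm : forall u, `|isometric_fun u| = `|u|;
  isometric_surj : forall v, exists u, isometric_fun u = v }.

Variable phi : isometric_iso A (dual F).

Fact predual_embed_scalar (x : F) : scalar (fun a => phi a x).
Proof. by move=> c a b; rewrite linearP. Qed.

Fact predual_embed_bound (x : F) a : `|phi a x| <= `|x| * `|a|.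
Proof. by rewrite (le_trans (ler_dual _ _))// isometric_norm mulrC. Qed.

(* The canonical map of [F] into [F** = A*], where [A] is identified with [F*]
   by [phi]. *)
Definition predual_embed (x : F) : dual A :=
  mk_dual (predual_embed_scalar x) (predual_embed_bound x).

(* [F] is a submodule of [A*]. *)
Definition is_predual : Prop := forall (x : F) (a : A),
  range predual_embed (dual_lact a (predual_embed x)) /\
  range predual_embed (dual_ract (predual_embed x) a).

Definition predual_perp : set (bidual A) :=
  [set m : bidual A | forall x, m (predual_embed x) = 0].

End dual_banach_algebra.

(* Main.v *)
(* Every [m] in [A**] splits as [a + n] with [a] in [A] and [n] in the
   annihilator of the predual, and [a], [n] are orthogonal, so that
   [P m = P a + P n].  As [n] squares to zero it is orthogonal to itself, hence
   [2 ^ k * P n = P (n + n) = 2 * P n] and [P n = 0].  The restriction of [P] to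
   [A] is [a |-> g (a ^ k)] for some [g], and [m ^ k = a ^ k]; so [P] is
   represented by [g] composed with the projection of [A**] onto [A]. *)
Require Import Defs.
From mathcomp Require Import all_boot all_order all_algebra.
From mathcomp Require Import complex.
From mathcomp Require Import boolp classical_sets functions filter reals.
From mathcomp Require Import topology normedtype.

Set Implicit Arguments.
Unset Strict Implicit.
Unset Printing Implicit Defensive.

Import Order.TTheory GRing.Theory Num.Theory.
Import numFieldNormedType.Exports.

Local Open Scope classical_set_scope.
Local Open Scope ring_scope.
Local Open Scope complex_scope.

Section multilinear.
Variables (R : realType) (B : banachAlgType R[i]) (k : nat).
Variable Phi : ('I_k -> B) -> R[i].
Hypothesis Phi_lin : multilinear_form Phi.

(** Linearity frees one scalar per slot, so the slots are scaled one at a time: the induction is on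
    the length [j] of the prefix of coordinates already multiplied by [c]. *)
Lemma multilinear_formZ (c : R[i]) (x : 'I_k -> B) :
  Phi (fun i => c *: x i) = c ^+ k * Phi x.
Proof.
suff prefixZ j : (j <= k)%N ->
    Phi (fun i : 'I_k => if (i < j)%N then c *: x i else x i) = c ^+ j * Phi x.
  by rewrite -prefixZ//; congr Phi; apply/funext => i; rewrite ltn_ord.
elim: j => [|j IH] jk; first by rewrite mul1r.
pose y (i : 'I_k) := if (i < j)%N then c *: x i else x i.
pose j0 := Ordinal jk.
have yE t i : i != j0 -> dfwith y (i := j0) t i = y i.
  by move=> ij; rewrite dfwith_out// eq_sym.
have dfwithZ a : (fun i => if i == j0 then a *: x i else y i) =
    dfwith y (i := j0) (a *: x j0).
  by apply/funext => i; have [->|ij] := eqVneq; rewrite ?dfwith_in ?yE.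
have PhiZ a : Phi (dfwith y (i := j0) (a *: x j0)) =
    a * Phi (dfwith y (i := j0) (x j0)).
  exact: (GRing.scalable_linear (Phi_lin y j0)).
rewrite exprS -mulrA -IH ?(ltnW jk)//.
transitivity (Phi (dfwith y (i := j0) (c *: x j0))).
  congr Phi; rewrite -dfwithZ; apply/funext => i; rewrite /y ltnS leq_eqVlt.
  by rewrite -(inj_eq val_inj)/=; case: eqP.
(* With the scalar 1, [dfwithZ] shows that writing [x j0] into slot [j0] leaves [y] unchanged, since
   [j0] lies outside the scaled prefix. *)
rewrite PhiZ; congr (_ * Phi _); rewrite -[x j0]scale1r -dfwithZ.
apply/funext => i; have [->|//] := eqVneq.
by rewrite scale1r ltnn.
Qed.

End multilinear.

Lemma orthogonally_additive_sq0 (R : realType) (B : banachAlgType R[i]) (k : nat)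
    (P : B -> R[i]) (x : B) : (2 <= k)%N -> homogeneous_polynomial k P ->
  orthogonally_additive P -> x ** x = 0 -> P x = 0.
Proof.
move=> k2 [Phi [Phi_lin _ _ PE]] Padd xx0.
have := Padd _ _ xx0 xx0.
rewrite -mulr2n -mulr2n -scaler_nat [P (_ *: _)]PE.
rewrite (multilinear_formZ Phi_lin 2 (fun=> x)) -PE -[RHS]mulr_natl => /eqP.
rewrite -subr_eq0 -mulrBl mulf_eq0 => /orP[|/eqP//].
(* What remains is the case [2 ^+ k - 2 = 0], which [2 <= k] excludes. *)
case: k k2 {Phi Phi_lin PE} => [|[|k]]// _.
by rewrite subr_eq0 -natrX eqr_nat (eqn_exp2l _ 1).
Qed.

Lemma bexpSS (R : realType) (B : banachAlgType R[i]) (x : B) k :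
  bexp x k.+2 = x ** bexp x k.+1.
Proof. by []. Qed.

Section embed.
Variables (R : realType) (A : banachAlgType R[i]).
Implicit Types a b : A.

Lemma ler_norm_embed a : `|embed a| <= `|a|.
Proof. exact: mk_dual_ler. Qed.

Lemma embed_linear : linear (@embed R A).
Proof. by move=> c a b; apply/dualP => f; rewrite /= linearP. Qed.

(** In the adjoint form [arensE] of the product, both sides take [f] to [f (a ** b)]. *)
Lemma embed_bmul a b : embed (a ** b) = embed a ** embed b.
Proof. by apply/dualP => f; rewrite [RHS]arensE. Qed.

Lemma embed_bexp a k : embed (bexp a k.+1) = bexp (embed a) k.+1.
Proof. by elim: k => // k IH; rewrite !bexpSS embed_bmul IH. Qed.

Lemma homogeneous_polynomial_embed k (P : bidual A -> R[i]) :
  homogeneous_polynomial k P -> homogeneous_polynomial k (P \o @embed R A).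
Proof.
move=> [Phi [Phi_lin Phi_sym [M PhiM] PE]].
exists (fun x => Phi (@embed R A \o x)); split.
- move=> x i c a b.
  have embed_dfwith t : @embed R A \o dfwith x (i := i) t =
      dfwith (@embed R A \o x) (i := i) (embed t).
    apply/funext => j /=; have [->|ij] := eqVneq i j.
      by rewrite !dfwith_in.
    by rewrite !dfwith_out.
  by rewrite !embed_dfwith embed_linear; exact: Phi_lin.
- by move=> s x; exact: (Phi_sym s (@embed R A \o x)).
(* The sign of [M] is unknown, and enlarging the norms in the product needs a nonnegative constant.
   Since [M] times the product dominates a norm, it is nonnegative, so it equals its own norm and
   [M] may be replaced by its modulus. *)
- exists `|M| => x; have := PhiM (@embed R A \o x).
  move=> /[dup] /le_trans le /(le_trans (normr_ge0 _)) /ger0_norm ME.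
  apply: le; rewrite -ME normrM ler_wpM2l// ger0_norm ?prodr_ge0//.
  by apply: ler_prod => i _; rewrite normr_ge0 ler_norm_embed.
- by move=> a /=; rewrite PE.
Qed.

(** Being an algebra homomorphism, [embed] carries orthogonal pairs to orthogonal pairs. *)
Lemma orthogonally_additive_embed (P : bidual A -> R[i]) :
  orthogonally_additive P -> orthogonally_additive (P \o @embed R A).
Proof.
move=> Padd a b ab ba /=.
have embedD : embed (a + b) = embed a + embed b.
  by apply/dualP => f; rewrite /= linearD.
have embed0 : embed (0 : A) = 0 by apply/dualP => f; rewrite /= linear0.
by rewrite embedD Padd// -embed_bmul (ab, ba).
Qed.

End embed.

Section predual_projection.
Variables (R : realType) (A : banachAlgType R[i]).
Variables (F : completeNormedModType R[i]) (phi : isometric_iso A (dual F)).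
Implicit Types (a : A) (m : bidual A).

Fact predual_restr_scalar m : scalar (fun x => m (predual_embed phi x)).
Proof.
move=> c x y; rewrite -linearP; congr (m _); apply/dualP => a.
by rewrite /= linearP.
Qed.

Fact predual_restr_bound m x : `|m (predual_embed phi x)| <= `|m| * `|x|.
Proof.
by rewrite (le_trans (ler_dual _ _))// ler_wpM2l// mk_dual_ler.
Qed.

Definition predual_restr m : dual F :=
  mk_dual (predual_restr_scalar m) (predual_restr_bound m).

(** Restriction of functionals from [A*] to [F], followed by the inverse of [phi]: the projection of
    [A**] onto [A] whose kernel is the annihilator of [F]. *)
Definition predual_proj m : A :=
  projT1 (cid (isometric_surj phi (predual_restr m))).

Lemma predual_projK m : phi (predual_proj m) = predual_restr m.
Proof. exact: projT2 (cid (isometric_surj phi (predual_restr m))). Qed.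

Lemma isometric_iso_inj : injective phi.
Proof.
move=> a b /eqP; rewrite -subr_eq0 -linearB -normr_eq0 isometric_norm.
by rewrite normr_eq0 subr_eq0 => /eqP.
Qed.

Lemma predual_proj_linear : linear predual_proj.
Proof.
move=> c m n; apply: isometric_iso_inj; rewrite linearP !predual_projK.
exact/dualP.
Qed.

Lemma ler_norm_predual_proj m : `|predual_proj m| <= `|m|.
Proof.
by rewrite -(isometric_norm phi) predual_projK mk_dual_ler.
Qed.

Lemma predual_proj_embed a : predual_proj (embed a) = a.
Proof.
by apply: isometric_iso_inj; rewrite predual_projK; apply/dualP.
Qed.

Lemma predual_perp_proj m : predual_perp phi (m - embed (predual_proj m)).
Proof.
by move=> x; rewrite dualBE/= predual_projK subrr.
Qed.

Fact predual_proj_comp_scalar (g : dual A) : scalar (g \o predual_proj).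
Proof. by move=> c m n /=; rewrite predual_proj_linear linearP. Qed.

Fact predual_proj_comp_bound (g : dual A) m :
  `|(g \o predual_proj) m| <= `|g| * `|m|.
Proof.
by rewrite (le_trans (ler_dual _ _))// ler_wpM2l// ler_norm_predual_proj.
Qed.

Definition predual_proj_comp (g : dual A) : dual (bidual A) :=
  mk_dual (predual_proj_comp_scalar g) (predual_proj_comp_bound g).

End predual_projection.

(** Every product of two factors involving [y] vanishes. The exponent starts at 2 because [y]
    survives in the first power. *)
Lemma bexpD_orthogonal (R : realType) (B : banachAlgType R[i]) (x y : B) k :
  x ** y = 0 -> y ** x = 0 -> y ** y = 0 -> bexp (x + y) k.+2 = bexp x k.+2.
Proof.
move=> xy yx yy; elim: k => [|k IH].
  by rewrite !bexpSS bmulDl !bmulDr xy yx yy !addr0.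
have yE : y ** bexp x k.+2 = 0.
  (* Writing 0 as [0 *: 0] lets [bmulZl] show that 0 times anything is 0. *)
  by rewrite bexpSS bmulA yx -(scale0r 0) bmulZl !scale0r.
by rewrite bexpSS IH bmulDl yE addr0 -bexpSS.
Qed.

Theorem theorem3p3 (R : realType) (k : nat) (hk : (2 <= k)%N)
    (A : banachAlgType R[i]) (F : completeNormedModType R[i])
    (phi : isometric_iso A (dual F)) (predualF : is_predual phi)
    (hann : forall (a : A) (m : bidual A), predual_perp phi m ->
      embed a ** m = 0 /\ m ** embed a = 0)
    (hsq : forall m : bidual A, predual_perp phi m -> m ** m = 0) :
  OA_property A k -> OA_property (bidual A) k.
Proof.
move=> A_OA P Phom Padd.
have [g gE] := A_OA _ (homogeneous_polynomial_embed Phom)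
  (orthogonally_additive_embed Padd).
exists (predual_proj_comp phi g) => m.
set a := predual_proj phi m; set n := m - embed a.
have nF : predual_perp phi n by exact: predual_perp_proj.
have [an na] := hann a n nF; have nn := hsq n nF.
have -> : m = embed a + n by rewrite addrC subrK.
rewrite (Padd _ _ an na) (orthogonally_additive_sq0 hk Phom Padd nn) addr0.
(* Exposing [k] as [k'.+2] puts the power in the range where the summand [n] drops out. *)
case: k hk gE {A_OA Phom} => [|[|k']]// _ gE.
rewrite bexpD_orthogonal// -embed_bexp /= predual_proj_embed.
exact: gE.
Qed.
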